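(* Let $\mathbf{x}=(x_1,x_2,\ldots,x_k,\ldots)\in\mathbb{R}^{\infty}$ and let $K$ be a closed (vertical) strip in $\{s\in\mathbb{C}:\operatorname{Re}s>1\}$. Then $$\zeta_{\boldsymbol{\pi}}(\sigma_0)\leq|\zeta_{\mathbf{x}}(s)|\leq\zeta(\sigma_0)\quad\text{for any }s\in K,$$ where $\sigma_0=\min\{\operatorname{Re}s:s\in K\}$, $\zeta$ is the Riemann zeta function, and $\zeta_{\boldsymbol{\pi}}$ denotes $\zeta_{\mathbf{x}}$ for the constant sequence $\mathbf{x}=(\pi,\pi,\ldots)$.
   Context: Let $p_k$ denote the $k$-th prime number. $\mathbb{R}^{\infty}$ is the set of all real sequences $\mathbf{x}=(x_1,x_2,\ldots)$. For $\mathbf{x}\in\mathbb{R}^{\infty}$ define, for $\operatorname{Re}s>1$, $$\zeta_{\mathbf{x}}(s)=\sum_{n\ge1}\frac{e^{i\langle\mathbf{r}_n,\mathbf{x}\rangle}}{n^{s}},$$ where, if $n=\prod_k p_k^{\alpha_k}$ is the prime factorization of $n$, $\mathbf{r}_n=(\alpha_1,\alpha_2,\ldots)$ and $\langle\mathbf{r}_n,\mathbf{x}\rangle=\sum_k\alpha_k x_k$ (a finite sum). The series converges absolutely for $\operatorname{Re}s>1$. Thus $\zeta_{\boldsymbol{\pi}}(s)=\sum_{n\ge1}\lambda(n)n^{-s}$ with $\lambda$ the Liouville function. A closed strip in $\{\operatorname{Re}s>1\}$ is a set $\{s\in\mathbb{C}:a\le\operatorname{Re}s\le b\}$ with $1<a\le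 b<\infty$. *)

(* Defs.v *)
From mathcomp Require Import all_boot all_order all_algebra complex.
From mathcomp Require Import all_classical all_reals all_analysis.
Set Implicit Arguments.
Unset Strict Implicit.
Unset Printing Implicit Defensive.
Import Order.TTheory GRing.Theory Num.Theory numFieldNormedType.Exports.
Local Open Scope classical_set_scope.
Local Open Scope ring_scope.
Local Open Scope complex_scope.

Lemma ex_prime_above (n : nat) : exists p : nat, (n < p)%N && prime p.
Proof. by have [p lt_np p_pr] := prime_above n; exists p; rewrite lt_np. Qed.

(* Primes and the sequences they index are numbered from 0: [nth_prime k] is
   p_(k+1), and [x k] stands for x_(k+1). *)
Fixpoint nth_prime (k : nat) : nat :=
  if k is k'.+1 then ex_minn (ex_prime_above (nth_prime k')) else 2%N.

(* For n > 0 only finitely many terms are nonzero, so this finitely supported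
   sum over all k is the genuine sum. *)
Definition rdot (R : realType) (n : nat) (x : nat -> R) : R :=
  \sum_(k \in [set: nat]) (logn (nth_prime k) n)%:R * x k.

Definition cexp (R : realType) (z : R[i]) : R[i] :=
  (expR (complex.Re z))%:C * (cos (complex.Im z) +i* sin (complex.Im z)).

(* n ^ s with the real logarithm of n, for n > 0 *)
Definition nat_cpow (R : realType) (n : nat) (s : R[i]) : R[i] :=
  cexp (s * (ln (n%:R : R))%:C).

(* The topology on R[i] is the one of its regular module R[i]^o, i.e. the usual
   topology of the complex modulus. This sum and the next are meaningful when
   1 < Re s, where they converge absolutely. *)
Definition zeta_seq (R : realType) (x : nat -> R) (s : R[i]) : R[i] :=
  limn (fun N : nat =>
    \sum_(1 <= n < N) cexp ('i * (rdot n x)%:C) / nat_cpow n s : R[i]^o).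

Definition riemann_zeta (R : realType) (s : R[i]) : R[i] :=
  limn (fun N : nat => \sum_(1 <= n < N) (nat_cpow n s)^-1 : R[i]^o).

Definition closed_strip (R : realType) (K : set R[i]) : Prop :=
  exists a b : R,
    [/\ 1 < a, a <= b & K = [set s : R[i] | a <= complex.Re s <= b]].

Definition is_minimum (R : realType) (A : set R) (m : R) : Prop :=
  A m /\ lbound A m.

(* Main.v *)
Require Import Defs.
From mathcomp Require Import all_boot all_order all_algebra complex.
From mathcomp Require Import all_classical all_reals all_analysis.
From mathcomp Require Import ring lra zify.
Set Implicit Arguments.
Unset Strict Implicit.
Unset Printing Implicit Defensive.
Import Order.TTheory GRing.Theory Num.Theory numFieldNormedType.Exports.
Local Open Scope classical_set_scope.
Local Open Scope ring_scope.
Local Open Scope complex_scope.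

(* The upper bound is the triangle inequality. For the lower bound let f be
   completely multiplicative with an absolutely convergent series of sum S.
   Sieving out the multiples of the primes below m leaves
   S * prod_(p < m) (1 - f p), which differs from f 1 = 1 by at most a tail of
   the series of |f|, hence tends to 1. For f n = e^(i <r_n, x>) / n^s the
   factors satisfy |1 - f p| <= 1 + p^(- sigma0), with equality for
   x = (pi, pi, ...) and s = sigma0. So with
   Q m = prod_(p < m) (1 + p^(- sigma0)) >= 1, the product zeta_pi(sigma0) * Q m
   tends to 1 while |zeta_x(s)| * Q m is asymptotically at least 1. *)

(** * Limits, moduli and absolute convergence in [R[i]] *)

Lemma cvg_real_complex (R : realType) (u : nat -> R) (l : R) :
  u @ \oo --> l -> (fun n => (u n)%:C : R[i]^o) @ \oo --> (l%:C : R[i]^o).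
Proof.
move=> /cvgrPdist_lt ul; apply/cvgrPdist_lt => -[e e'].
(* A positive element of [R[i]] is real, so the radius has [e' = 0]. *)
rewrite ltcE /= => /andP[/eqP -> e0].
apply: filterS (ul e e0) => n.
by rewrite -rmorphB normc_def /= expr0n addr0 sqrtr_sqr ltcR.
Qed.

(** The modulus takes values in [R[i]]; this form lets [lecR] carry comparisons of moduli over to
    [R]. *)
Lemma normC_Re (R : realType) (z : R[i]) : `|z| = (complex.Re `|z|)%:C.
Proof. by rewrite normc_def. Qed.

Lemma normC_real (R : realType) (x : R) : `|x%:C| = `|x|%:C.
Proof. by rewrite normc_def /= expr0n addr0 sqrtr_sqr. Qed.

Lemma cvg_Re (R : realType) (u : nat -> R[i]) (l : R[i]) :
  (fun n => u n : R[i]^o) @ \oo --> (l : R[i]^o) ->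
  (fun n => complex.Re (u n)) @ \oo --> complex.Re l.
Proof.
move=> /cvgrPdist_lt ul; apply/cvgrPdist_lt => e e0.
have e0' : 0 < e%:C by rewrite ltcR.
apply: filterS (ul _ e0') => n /= lt_e.
rewrite -ltcR; apply: le_lt_trans lt_e.
by rewrite -raddfB; exact: normc_ge_Re.
Qed.

Lemma cvg_Re_norm (R : realType) (u : nat -> R[i]) (l : R[i]) :
  (fun n => u n : R[i]^o) @ \oo --> (l : R[i]^o) ->
  (fun n => complex.Re `|u n|) @ \oo --> complex.Re `|l|.
Proof. by move=> ul; apply: cvg_Re; exact: (cvg_norm (V := R[i]^o) ul). Qed.

Lemma normC_lim_le (R : realType) (u : nat -> R[i]) (l : R[i]) (c : R) :
  (fun n => u n : R[i]^o) @ \oo --> (l : R[i]^o) ->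
  (\forall n \near \oo, `|u n| <= c%:C) -> `|l| <= c%:C.
Proof.
move=> /cvg_Re_norm ul uc; rewrite normC_Re lecR.
apply: (cvgr_to_le ul); apply: filterS uc => n.
by rewrite normC_Re lecR.
Qed.

(** Real and imaginary parts are both dominated by [g], so each converges absolutely in [R]; the
    limits are then recombined. *)
Lemma cvg_complex_series (R : realType) (f : nat -> R[i]) (g : nat -> R) :
  (forall n, `|f n| <= (g n)%:C) -> cvgn (series g) ->
  cvgn (series f : nat -> R[i]^o).
Proof.
move=> fg cg.
have part (h : nat -> R) : (forall n, `|h n| <= g n) -> cvgn (series h).
  move=> hg; apply: normed_cvg.
  by apply: (series_le_cvg _ _ hg cg) => n //; apply: le_trans (hg n).
have cRe : cvgn (series (fun n => complex.Re (f n))).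
  by apply: part => n; rewrite -lecR; apply: le_trans (normc_ge_Re _) (fg n).
have cIm : cvgn (series (fun n => complex.Im (f n))).
  apply: part => n; rewrite -lecR; apply: le_trans (fg n).
  (* The imaginary part is the real part after a rotation by [- 'i], which preserves the modulus. *)
  have := normc_ge_Re (f n * - 'i).
  by rewrite mulrN raddfN /= ReiNIm opprK normrN normrM normCi mulr1.
have -> : (series f : nat -> R[i]^o) = fun n =>
    ((series (fun n => complex.Re (f n)) n)%:C : R[i]^o) +
    'i * ((series (fun n => complex.Im (f n)) n)%:C : R[i]^o).
  apply/funext => n; rewrite /series/= !rmorph_sum/= mulr_sumr -big_split/=.
  by apply: eq_bigr => i _; rewrite -complexE.
apply/cvg_ex; eexists.
apply: cvgD (cvg_real_complex cRe) _.
exact: cvgMr (cvg_real_complex cIm).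
Qed.

(** * The enumeration of the primes and the additivity of [rdot] *)

Lemma nth_primeS (k : nat) :
  [/\ prime (nth_prime k.+1), (nth_prime k < nth_prime k.+1)%N &
    forall p, prime p -> (nth_prime k < p)%N -> (nth_prime k.+1 <= p)%N].
Proof.
rewrite /=; case: ex_minnP => q /andP[-> ->] q_min; split=> // p p_pr lt_p.
by apply: q_min; rewrite lt_p.
Qed.

Lemma nth_prime_prime (k : nat) : prime (nth_prime k).
Proof. by case: k => // k; have [] := nth_primeS k. Qed.

Lemma ltn_nth_prime : {mono nth_prime : i j / (i < j)%N}.
Proof.
have step k : (nth_prime k < nth_prime k.+1)%N by have [] := nth_primeS k.
by apply: leqW_mono; apply: leq_mono; exact: (homo_ltn ltn_trans step).
Qed.

Lemma nth_prime_inj : injective nth_prime.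
Proof.
move=> i j eq_ij; case: (ltngtP i j) => // lt_ij.
- by have := ltn_nth_prime i j; rewrite lt_ij eq_ij ltnn.
- by have := ltn_nth_prime j i; rewrite lt_ij eq_ij ltnn.
Qed.

Lemma nth_prime_gt (k : nat) : (k < nth_prime k)%N.
Proof.
elim: k => // k IHk; apply: leq_ltn_trans IHk _.
by rewrite ltn_nth_prime.
Qed.

(** Some [nth_prime k] is at least [p] by [nth_prime_gt]; going down in [k], minimality of the next
    prime leaves no prime strictly between consecutive values. *)
Lemma nth_prime_surj (p : nat) : prime p -> exists k, nth_prime k = p.
Proof.
move=> p_pr; suff: forall k, (p <= nth_prime k)%N -> exists k, nth_prime k = p.
  by apply; exact: ltnW (nth_prime_gt p).
elim=> [|k IHk] le_p.
  by exists 0%N; apply/eqP; rewrite eqn_leq le_p prime_gt1.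
have [/IHk//|lt_p] := leqP p (nth_prime k).
have [_ _ /(_ p p_pr lt_p) le_p'] := nth_primeS k.
by exists k.+1; apply/eqP; rewrite eqn_leq le_p le_p'.
Qed.

(** Since [k < nth_prime k], a prime of index at least [N >= n] exceeds [n] and cannot divide it.
    The free bound [N] gives several integers a common range of summation. *)
Lemma rdotE (R : realType) (n N : nat) (x : nat -> R) :
  (0 < n <= N)%N ->
  rdot n x = \sum_(0 <= k < N) (logn (nth_prime k) n)%:R * x k.
Proof.
move=> /andP[n0 nN]; rewrite /rdot (fsbigE (index_iota 0 N)) ?iota_uniq//.
  by apply: eq_bigl => k; rewrite in_setT.
move=> k _; rewrite mem_index_iota /= -leqNgt => le_k.
suff -> : logn (nth_prime k) n = 0%N by rewrite mul0r.
apply/eqP; rewrite -leqn0 leqNgt logn_gt0 mem_primes nth_prime_prime n0/=.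
apply/negP => /(dvdn_leq n0); apply/negP; rewrite -ltnNge.
exact: leq_ltn_trans (leq_trans nN le_k) (nth_prime_gt k).
Qed.

Lemma rdotM (R : realType) (m n : nat) (x : nat -> R) :
  (0 < m)%N -> (0 < n)%N -> rdot (m * n) x = rdot m x + rdot n x.
Proof.
move=> m0 n0.
rewrite (@rdotE _ (m * n) (m * n)) ?muln_gt0 ?m0 ?n0 ?leqnn//.
rewrite (@rdotE _ m (m * n)) ?m0 ?leq_pmulr//.
rewrite (@rdotE _ n (m * n)) ?n0 ?leq_pmull// -big_split/=.
by apply: eq_bigr => k _; rewrite lognM// natrD mulrDl.
Qed.

Lemma rdot1 (R : realType) (x : nat -> R) : rdot 1 x = 0.
Proof. by rewrite (@rdotE _ 1 1)// big_nat1 logn1 mul0r. Qed.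

Lemma rdot_cst_prime (R : realType) (p : nat) (c : R) :
  prime p -> rdot p (fun=> c) = c.
Proof.
move=> p_pr; have [j jp] := nth_prime_surj p_pr.
rewrite (@rdotE _ p p) ?leqnn ?prime_gt0//.
rewrite (bigD1_seq j) ?iota_uniq ?mem_index_iota//=; last first.
  by rewrite -jp nth_prime_gt.
rewrite logn_prime// jp eqxx mul1r big1 ?addr0// => i ij.
rewrite logn_prime// -jp.
by rewrite (inj_eq nth_prime_inj) (negPf ij) mul0r.
Qed.

(** The witness is the number of prime factors counted with multiplicity; for [c = pi] its parity
    gives the Liouville sign. *)
Lemma rdot_cst (R : realType) (n : nat) (c : R) :
  exists k : nat, rdot n.+1 (fun=> c) = k%:R * c.
Proof.
exists (\sum_(0 <= k < n.+1) logn (nth_prime k) n.+1)%N.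
by rewrite (@rdotE _ n.+1 n.+1) ?leqnn// natr_sum mulr_suml.
Qed.

(** * The complex exponential and the terms of the Dirichlet series *)

Lemma cexpD (R : realType) (z w : R[i]) : cexp (z + w) = cexp z * cexp w.
Proof.
case: z w => [a b] [c d]; rewrite /cexp /= expRD cosD sinD.
by simpc; congr (_ +i* _); ring.
Qed.

Lemma cexp0 (R : realType) : cexp (0 : R[i]) = 1.
Proof. by rewrite /cexp /= expR0 cos0 sin0 mul1r. Qed.

Lemma norm_cexp (R : realType) (z : R[i]) :
  `|cexp z| = (expR (complex.Re z))%:C.
Proof.
rewrite /cexp normrM normC_real (ger0_norm (expR_ge0 _)).
by rewrite [X in _ * X]normc_def /= cos2Dsin2 sqrtr1 mulr1.
Qed.

Lemma mul_imaginary_unit (R : realType) (y : R) : 'i * y%:C = 0 +i* y.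
Proof. by simpc. Qed.

Lemma mul_complex_real (R : realType) (z : R[i]) (y : R) :
  z * y%:C = (complex.Re z * y) +i* (complex.Im z * y).
Proof. by case: z => a b; simpc. Qed.

Lemma cexp_pi (R : realType) : cexp ('i * (pi : R)%:C) = -1.
Proof.
rewrite mul_imaginary_unit /cexp /= expR0 cospi sinpi.
by simpc.
Qed.

Lemma cexp_nat (R : realType) (k : nat) (z : R[i]) :
  cexp (k%:R * z) = cexp z ^+ k.
Proof.
elim: k => [|k IHk]; first by rewrite mul0r cexp0.
by rewrite -natr1 mulrDl mul1r cexpD IHk exprSr.
Qed.

(* The value 0 at n = 0 (here and in zeta_term) makes the term completely
   multiplicative on all of nat and lets the series start at 0. *)
Definition dirichlet_term (R : realType) (x : nat -> R) (s : R[i]) (n : nat) :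
    R[i] :=
  if n is 0 then 0 else cexp ('i * (rdot n x)%:C) / nat_cpow n s.

Definition zeta_term (R : realType) (a : R) (n : nat) : R :=
  if n is 0 then 0 else expR (- (a * ln n%:R)).

Lemma zeta_term_ge0 (R : realType) (a : R) (n : nat) : 0 <= zeta_term a n.
Proof. by case: n => //= n; exact: expR_ge0. Qed.

Lemma le_zeta_term (R : realType) (a b : R) (n : nat) :
  a <= b -> zeta_term b n <= zeta_term a n.
Proof.
case: n => //= n ab; rewrite ler_expR lerN2 ler_wpM2r// ln_ge0//.
by rewrite ler1n.
Qed.

Lemma nat_cpow_real (R : realType) (n : nat) (a : R) :
  (nat_cpow n.+1 a%:C)^-1 = (zeta_term a n.+1)%:C.
Proof.
rewrite /nat_cpow mul_complex_real /cexp /= mul0r cos0 sin0.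
by rewrite mulr1 expRN fmorphV.
Qed.

Lemma nat_cpowM (R : realType) (m n : nat) (s : R[i]) :
  (0 < m)%N -> (0 < n)%N ->
  nat_cpow (m * n) s = nat_cpow m s * nat_cpow n s.
Proof.
move=> m0 n0; rewrite /nat_cpow natrM lnM ?posrE ?ltr0n//.
by rewrite rmorphD mulrDr cexpD.
Qed.

Lemma dirichlet_term1 (R : realType) (x : nat -> R) (s : R[i]) :
  dirichlet_term x s 1 = 1.
Proof. by rewrite /= rdot1 /nat_cpow ln1 !mulr0 cexp0 divr1. Qed.

Lemma dirichlet_termM (R : realType) (x : nat -> R) (s : R[i]) (m n : nat) :
  dirichlet_term x s (m * n) = dirichlet_term x s m * dirichlet_term x s n.
Proof.
case: m => [|m]; first by rewrite mul0r.
case: n => [|n]; first by rewrite muln0 mulr0.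
rewrite {1}/dirichlet_term -[(m.+1 * n.+1)%N]prednK ?muln_gt0// prednK//.
rewrite rdotM// nat_cpowM// rmorphD mulrDr cexpD invfM /=.
by rewrite mulrACA.
Qed.

Lemma norm_dirichlet_term (R : realType) (x : nat -> R) (s : R[i]) (n : nat) :
  `|dirichlet_term x s n| = (zeta_term (complex.Re s) n)%:C.
Proof.
case: n => [|n]; first by rewrite normr0.
rewrite /= normrM normrV ?unitfE -?normr_gt0 ?norm_cexp ?ltcR ?expR_gt0//.
rewrite mul_imaginary_unit mul_complex_real /= expR0 mul1r.
by rewrite expRN fmorphV.
Qed.

(** The extremal case: the phase at a prime is [e^(i pi) = -1], so the Euler factor [1 - f p]
    becomes [1 + p^(- a)]. *)
Lemma dirichlet_term_pi_prime (R : realType) (a : R) (p : nat) :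
  prime p -> dirichlet_term (fun=> pi) a%:C p = - (zeta_term a p)%:C.
Proof.
move=> p_pr; rewrite -(prednK (prime_gt0 p_pr)) /dirichlet_term nat_cpow_real.
by rewrite prednK ?prime_gt0// rdot_cst_prime// cexp_pi mulN1r.
Qed.

(** The phase is a power of [e^(i pi) = -1], and [n^(- a)] is real. *)
Lemma dirichlet_term_pi_real (R : realType) (a : R) (n : nat) :
  dirichlet_term (fun=> pi) a%:C n =
    (complex.Re (dirichlet_term (fun=> pi) a%:C n))%:C.
Proof.
case: n => // n; rewrite /dirichlet_term nat_cpow_real.
have [k ->] := rdot_cst n (pi : R).
rewrite rmorphM mulrCA rmorph_nat cexp_nat cexp_pi.
by rewrite -[-1](rmorphN1 (real_complex R)) -rmorphXn -rmorphM.
Qed.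

(* Telescoping: (a - 1) / n^a <= 1 / (n - 1)^(a - 1) - 1 / n^(a - 1), from
   e^u >= 1 + u and ln x <= x - 1. *)
Lemma cvg_zeta_term (R : realType) (a : R) :
  1 < a -> cvgn (series (zeta_term a)).
Proof.
move=> a1; have a0 : 0 < a - 1 by rewrite subr_gt0.
pose v (n : nat) : R := expR (- ((a - 1) * ln n%:R)).
have term_le n : (a - 1) * zeta_term a n.+2 <= v n.+1 - v n.+2.
  set l := ln (n.+2%:R : R) - ln n.+1%:R.
  have l_ge : n.+2%:R^-1 <= l.
    have -> : l = - ln (n.+1%:R / n.+2%:R).
      by rewrite ln_div ?posrE// opprB.
    have : ln (n.+1%:R / n.+2%:R) <= n.+1%:R / n.+2%:R - 1 :> R.
      have := @le_ln1Dx R (n.+1%:R / n.+2%:R - 1).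
      rewrite addrCA subrr addr0; apply.
      by rewrite ltrBrDl subrr divr_gt0.
    have -> : n.+1%:R / n.+2%:R - 1 = - n.+2%:R^-1 :> R.
      have y0 : 0 < n.+1%:R :> R by rewrite ltr0n.
      rewrite -[n.+2%:R]natr1; move: n.+1%:R y0 => y y0; field.
      by rewrite gt_eqF// addr_gt0.
    by rewrite lerNr.
  have -> : v n.+1 = v n.+2 * expR ((a - 1) * l).
    by rewrite /v -expRD; congr expR; rewrite /l; ring.
  have -> : zeta_term a n.+2 = v n.+2 * n.+2%:R^-1.
    have -> : (n.+2%:R : R)^-1 = expR (- ln n.+2%:R).
      by rewrite expRN lnK// posrE.
    by rewrite /v -expRD; congr expR; ring.
  rewrite -{3}[v n.+2]mulr1 -mulrBr mulrCA ler_wpM2l ?expR_ge0//.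
  apply: le_trans (_ : (a - 1) * l <= _); first by rewrite ler_wpM2l// ltW.
  by rewrite lerBrDl expR_ge1Dx.
apply: nondecreasing_is_cvgn.
  by apply: nondecreasing_series => n _ _; exact: zeta_term_ge0.
(* The term at 1 contributes 1, and the telescoped rest at most [v 1 / (a - 1)] with [v 1 = 1]. *)
exists (1 + (a - 1)^-1) => _ [N _ <-].
have bound M : series (zeta_term a) M.+2 <= 1 + (a - 1)^-1 * (1 - v M.+1).
  elim: M => [|M IHM].
    rewrite /series/= !big_nat_recr// big_geq//= /v ln1 !mulr0 oppr0 expR0.
    by rewrite subrr mulr0 !addr0 add0r.
  rewrite /series/= big_nat_recr//= -/(series (zeta_term a) M.+2).
  apply: le_trans (lerD IHM (lexx _)) _.
  rewrite -addrA lerD2l -lerBrDl -mulrBr -ler_pdivrMl ?invr_gt0// invrK.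
  apply: le_trans (term_le M) _; lra.
apply: (@le_trans _ _ (series (zeta_term a) N.+2)).
  apply: nondecreasing_series => [n _ _|]; first exact: zeta_term_ge0.
  by rewrite -addn2 leq_addr.
apply: le_trans (bound N) _; rewrite lerD2l ler_piMr ?invr_ge0 ?(ltW a0)//.
by rewrite gerBl expR_ge0.
Qed.

(** * The sieve by the primes below [m] and the Euler product *)

(** Counting from 0, the multiples of [d] below [N] number the ceiling of [N / d], which is
    [(N + d.-1) %/ d]. *)
Lemma sum_multiples (V : nmodType) (d N : nat) (F : nat -> V) :
  (0 < d)%N ->
  \sum_(0 <= n < N | (d %| n)%N) F n =
    \sum_(0 <= k < (N + d.-1) %/ d) F (d * k)%N.
Proof.
move=> d0; elim: N => [|N IHN].
  by rewrite add0n divn_small ?prednK// !big_geq.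
rewrite big_mkcond big_nat_recr//= -big_mkcond IHN /= addSnnS prednK//.
rewrite (divnDr N (dvdnn d)) divnn d0 addn1.
have [/dvdnP[q ->]|ndvd] := ifPn.
  rewrite divnMDl// divn_small ?prednK// addn0 mulnK// big_nat_recr//=.
  by rewrite mulnC.
(* When [d] does not divide [N], the ceiling of [N / d] is already [N %/ d + 1], so the range does
   not grow. *)
rewrite addr0; congr (\sum_(0 <= k < _) _).
rewrite [in LHS](divn_eq N d) -addnA divnMDl// -addn1; congr addn.
have r0 : (0 < N %% d)%N by rewrite lt0n.
have rd := ltn_pmod N d0.
apply/eqP; rewrite eqn_leq leq_divRL// mul1n -ltnS ltn_divLR//.
by apply/andP; split; lia.
Qed.

(** Boolean, so that it can filter a sum; [rough 0] filters nothing, hence the sieve starts from the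
    full partial sums. *)
Definition rough (m n : nat) : bool :=
  all (fun p => prime p ==> ~~ (p %| n)%N) (iota 0 m).

Lemma roughS (m n : nat) :
  rough m.+1 n = rough m n && (prime m ==> ~~ (m %| n)%N).
Proof. by rewrite /rough -addn1 iotaD all_cat /= andbT add0n. Qed.

(** A prime below [m] differs from the prime [m], so it can divide the product only through [k]. *)
Lemma rough_primeM (m k : nat) : prime m -> rough m (m * k) = rough m k.
Proof.
move=> m_pr; apply: eq_in_all => p; rewrite mem_iota /= add0n => lt_pm.
have [p_pr|//] := boolP (prime p); rewrite /= Euclid_dvdM//.
by rewrite dvdn_prime2// ltn_eqF.
Qed.

(** Otherwise the least prime factor of [n] would lie below [m]. *)
Lemma rough_geq (m n : nat) : (1 < n)%N -> rough m n -> (m <= n)%N.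
Proof.
move=> n1 /allP rough_n; rewrite leqNgt; apply/negP => lt_nm.
have := rough_n (pdiv n); rewrite mem_iota /= add0n pdiv_prime// pdiv_dvd /=.
by rewrite (leq_ltn_trans (pdiv_leq (ltnW n1)) lt_nm) => /(_ isT).
Qed.

(** Induction on [m]: for [m] prime, the next sieving step drops the terms [f (m * k) = f m * f k]
    with [k] rough, whose sum tends to [f m] times the current limit. *)
Lemma cvg_rough_sum (R : realType) (f : nat -> R[i]) (S : R[i]) (m : nat) :
  (forall k n, f (k * n)%N = f k * f n) ->
  (series f : nat -> R[i]^o) @ \oo --> (S : R[i]^o) ->
  (fun N => \sum_(0 <= n < N | rough m n) f n : R[i]^o) @ \oo -->
    (S * \prod_(0 <= p < m | prime p) (1 - f p) : R[i]^o).
Proof.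
move=> fM fS.
pose T m N : R[i] := \sum_(0 <= n < N | rough m n) f n.
pose E m : R[i] := \prod_(0 <= p < m | prime p) (1 - f p).
rewrite -/(E m) -[X in X @ _]/(T m : nat -> R[i]^o).
have E0 : E 0%N = 1 by rewrite /E big_geq.
have ES k : E k.+1 = E k * (if prime k then 1 - f k else 1).
  by rewrite /E [LHS]big_mkcond big_nat_recr//= -big_mkcond.
have T0 : T 0%N = series f by apply/funext => N; exact: eq_bigl.
elim: m => [|m IHm]; first by rewrite E0 mulr1 T0.
rewrite ES; case: ifPn => [m_pr|/negPf m_npr]; last first.
  rewrite mulr1; suff -> : T m.+1 = T m by [].
  by apply/funext => N; apply: eq_bigl => n; rewrite roughS m_npr andbT.
have m0 := prime_gt0 m_pr.
(* An exact identity at each finite [N]: the multiples of [m] below [N] are the [m * k] with [k]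
   below the ceiling of [N / m]. *)
have -> : T m.+1 = fun N => T m N - f m * T m ((N + m.-1) %/ m)%N.
  apply/funext => N; rewrite /T [in RHS](bigID (fun n => (m %| n)%N))/=.
  under eq_bigl do rewrite roughS m_pr /=.
  rewrite [X in X + _ - _](_ : _ =
      f m * \sum_(0 <= k < (N + m.-1) %/ m | rough m k) f k).
    by rewrite [X in X - _]addrC addrK.
  under eq_bigl do rewrite andbC.
  rewrite big_mkcondr /= sum_multiples// mulr_sumr [RHS]big_mkcond /=.
  by apply: eq_bigr => k _; rewrite rough_primeM// fM.
rewrite mulrA mulrBr mulr1 [X in _ - X]mulrC.
(* The rescaled cutoff also tends to infinity with [N], so the limit is unchanged. *)
have cT : (fun N => T m ((N + m.-1) %/ m)%N : R[i]^o) @ \oo -->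
    (S * E m : R[i]^o).
  apply: (cvg_comp _ _ _ IHm); apply/cvgnyPge => M; near=> N.
  rewrite leq_divRL// (leq_trans _ (leq_addr _ _))//.
  by near: N; exact: nbhs_infty_ge.
exact: (cvgB (V := R[i]^o) IHm (cvgMr (a := f m : R[i]^o) cT)).
Unshelve. all: end_near.
Qed.

(** By [rough_geq] the only nonzero term that survives below [m] is [f 1 = 1]; the others are
    dominated by the tail of [series g] from [m] on. *)
Lemma sieve_le (R : realType) (f : nat -> R[i]) (g : nat -> R) (m N : nat) :
  f 0%N = 0 -> f 1%N = 1 -> (forall n, `|f n| <= (g n)%:C) -> cvgn (series g) ->
  (1 < m)%N -> (1 < N)%N ->
  `|\sum_(0 <= n < N | rough m n) f n - 1| <= (limn (series g) - series g m)%:C.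
Proof.
move=> f0 f1 fg cg m1 N1.
have g0 n : 0 <= g n by rewrite -ler0c (le_trans _ (fg n)).
have rough1 : rough m 1.
  by apply/allP => p _; apply/implyP => p_pr; rewrite dvdn1 gtn_eqF// prime_gt1.
have -> : \sum_(0 <= n < N | rough m n) f n - 1 =
    \sum_(2 <= n < N | rough m n) f n.
  rewrite big_ltn_cond ?(ltnW N1)// big_ltn_cond// f0 f1 rough1 add0r.
  by rewrite if_same [X in X - _]addrC addrK.
apply: le_trans (ler_norm_sum _ _ _) _.
apply: (@le_trans _ _ (\sum_(2 <= n < N | rough m n) (g n)%:C)).
  by apply: ler_sum => n _.
rewrite -rmorph_sum lecR.
(* The bound [maxn m N] covers the case [N < m], so that this range and the one below [m] join into
   a single partial sum of [g]. *)
apply: (@le_trans _ _ (\sum_(m <= n < maxn m N) g n)).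
  rewrite (big_nat_widen _ _ (maxn m N)) ?leq_maxr//.
  rewrite big_mkcond [leRHS](big_nat_widenl m 2)//= [leRHS]big_mkcond /=.
  rewrite !big_seq; apply: ler_sum => n; rewrite mem_index_iota => /andP[n2 _].
  case: ifPn => [/andP[rn _]|_]; first by rewrite rough_geq.
  by case: ifP.
rewrite lerBrDr addrC -big_cat_nat ?leq_maxl//=.
apply: nondecreasing_cvgn_le => //.
by apply: nondecreasing_series => n _ _.
Qed.

(** Letting [N] tend to infinity in [sieve_le] with [m] fixed bounds the distance to 1 by a tail of
    [series g], which vanishes as [m] grows. *)
Lemma cvg_euler_product (R : realType) (f : nat -> R[i]) (g : nat -> R)
    (S : R[i]) :
  f 0%N = 0 -> f 1%N = 1 -> (forall k n, f (k * n)%N = f k * f n) ->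
  (forall n, `|f n| <= (g n)%:C) -> cvgn (series g) ->
  (series f : nat -> R[i]^o) @ \oo --> (S : R[i]^o) ->
  (fun m => S * \prod_(0 <= p < m | prime p) (1 - f p) : R[i]^o) @ \oo -->
    (1 : R[i]^o).
Proof.
move=> f0 f1 fM fg cg fS.
have tail m : (1 < m)%N ->
    `|S * \prod_(0 <= p < m | prime p) (1 - f p) - 1| <=
      (limn (series g) - series g m)%:C.
  move=> m1.
  apply: (normC_lim_le (cvgB (cvg_rough_sum (m := m) fM fS) (cvg_cst _))).
  by near=> N; apply: sieve_le => //; near: N; exact: nbhs_infty_gt.
apply/cvgrPdist_lt => -[e e']; rewrite ltcE /= => /andP[/eqP -> e0].
move/cvgrPdist_lt: cg => /(_ e e0) cg; near=> m.
rewrite distrC; apply: le_lt_trans (tail m _) _.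
  by near: m; exact: nbhs_infty_gt.
rewrite ltcR; apply: le_lt_trans (ler_norm _) _.
by near: m.
Unshelve. all: end_near.
Qed.

(** * The zeta functions as limits of series, and the two bounds *)

(** Reconciles the zeta sums, which start at 1, with [series], which starts at 0. *)
Lemma series_shift (V : nmodType) (f h : nat -> V) (N : nat) :
  f 0%N = 0 -> (forall n, f n.+1 = h n.+1) ->
  \sum_(1 <= n < N) h n = \sum_(0 <= n < N) f n.
Proof.
move=> f0 fh; case: N => [|N]; first by rewrite !big_geq.
rewrite [RHS]big_ltn// f0 add0r; by apply: eq_big_nat => -[|n].
Qed.

Lemma zeta_seqE (R : realType) (x : nat -> R) (s : R[i]) :
  zeta_seq x s = limn (series (dirichlet_term x s) : nat -> R[i]^o).
Proof.
apply: (congr1 (fun u : nat -> R[i]^o => limn u)); apply/funext => N.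
exact: (series_shift (f := dirichlet_term x s)).
Qed.

Lemma riemann_zetaE (R : realType) (a : R) :
  1 < a -> riemann_zeta a%:C = (limn (series (zeta_term a)))%:C.
Proof.
move=> /cvg_zeta_term/cvg_real_complex ca.
apply: (cvg_lim (@norm_hausdorff _ R[i]^o)); apply: cvg_trans ca.
apply: near_eq_cvg; near=> N; rewrite /series/= rmorph_sum /=.
rewrite -(series_shift (h := fun n => (nat_cpow n a%:C)^-1))// => n.
by rewrite -nat_cpow_real.
Unshelve. all: end_near.
Qed.

(** Makes the [limn] in [zeta_seq] a genuine limit rather than a default value. *)
Lemma cvg_dirichlet_series (R : realType) (x : nat -> R) (s : R[i]) :
  1 < complex.Re s ->
  (series (dirichlet_term x s) : nat -> R[i]^o) @ \oo -->
    (zeta_seq x s : R[i]^o).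
Proof.
move=> /cvg_zeta_term cs; rewrite zeta_seqE.
apply: (cvg_complex_series _ cs) => n.
by rewrite norm_dirichlet_term.
Qed.

Lemma norm_zeta_seq_le (R : realType) (x : nat -> R) (a : R) (s : R[i]) :
  1 < a -> a <= complex.Re s -> `|zeta_seq x s| <= riemann_zeta a%:C.
Proof.
move=> a1 a_s; rewrite riemann_zetaE//.
apply: (normC_lim_le (cvg_dirichlet_series (x := x) (lt_le_trans a1 a_s))).
near=> N; apply: le_trans (ler_norm_sum _ _ _) _.
apply: (@le_trans _ _ (series (zeta_term a) N)%:C).
  rewrite /series/= rmorph_sum; apply: ler_sum => n _.
  by rewrite norm_dirichlet_term lecR le_zeta_term.
rewrite lecR; apply: nondecreasing_cvgn_le; last exact: cvg_zeta_term.
by apply: nondecreasing_series => n _ _; exact: zeta_term_ge0.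
Unshelve. all: end_near.
Qed.

(** A limit of real partial sums. This allows the lower bound, stated in the order of [R[i]], to be
    proved in [R]. *)
Lemma zeta_seq_pi_real (R : realType) (a : R) :
  1 < a ->
  zeta_seq (fun=> pi) a%:C = (complex.Re (zeta_seq (fun=> pi) a%:C))%:C.
Proof.
move=> a1.
have ca := @cvg_dirichlet_series R (fun=> pi) a%:C a1.
apply: (cvg_unique (@norm_hausdorff _ R[i]^o) ca).
apply: cvg_trans (cvg_real_complex (cvg_Re ca)).
apply: near_eq_cvg; near=> N; rewrite /series/= !raddf_sum /=.
by apply: eq_bigr => n _; rewrite -dirichlet_term_pi_real.
Unshelve. all: end_near.
Qed.

Lemma cvg_zeta_euler (R : realType) (x : nat -> R) (s : R[i]) :
  1 < complex.Re s ->
  (fun m => zeta_seq x s *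
     \prod_(0 <= p < m | prime p) (1 - dirichlet_term x s p) : R[i]^o) @ \oo
    --> (1 : R[i]^o).
Proof.
move=> s1; apply: (cvg_euler_product _ _ _ _ (cvg_zeta_term s1)) => //.
- exact: dirichlet_term1.
- exact: dirichlet_termM.
- by move=> n; rewrite norm_dirichlet_term.
- exact: cvg_dirichlet_series.
Qed.

Lemma norm_zeta_seq_ge (R : realType) (x : nat -> R) (a : R) (s : R[i]) :
  1 < a -> a <= complex.Re s -> zeta_seq (fun=> pi) a%:C <= `|zeta_seq x s|.
Proof.
move=> a1 a_s.
have s1 := lt_le_trans a1 a_s.
have := @cvg_zeta_euler R (fun=> pi) a%:C a1.
have /cvg_Re_norm := cvg_zeta_euler x s1.
rewrite normr1 normC_Re zeta_seq_pi_real// lecR.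
set P := complex.Re (zeta_seq _ a%:C); set S := complex.Re `|zeta_seq x s|.
pose Q m : R := \prod_(0 <= p < m | prime p) (1 + zeta_term a p).
move=> cS /cvg_Re cP.
have Q1 m : 1 <= Q m.
  apply: (big_ind (fun y => 1 <= y)) => // [u v u1 v1|p _].
    by rewrite -[1]mulr1 ler_pM.
  by rewrite lerDl zeta_term_ge0.
(* For the constant sequence [pi] every Euler factor is exactly [1 + p^(- a)]. *)
have PE m : complex.Re (P%:C * \prod_(0 <= p < m | prime p)
    (1 - dirichlet_term (fun=> pi) a%:C p)) = P * Q m.
  under eq_bigr => p p_pr.
    rewrite dirichlet_term_pi_prime// opprK -[1](rmorph1 (real_complex R)).
    rewrite -rmorphD; over.
  by rewrite -rmorph_prod -rmorphM.
(* The triangle inequality in each Euler factor, followed by [p^(- Re s) <= p^(- a)]. *)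
have SE m : complex.Re `|zeta_seq x s * \prod_(0 <= p < m | prime p)
    (1 - dirichlet_term x s p)| <= S * Q m.
  rewrite -lecR -normC_Re normrM rmorphM /= /S -normC_Re ler_wpM2l//.
  rewrite normr_prod rmorph_prod; apply: ler_prod => p _; rewrite normr_ge0 /=.
  apply: le_trans (ler_normB _ _) _.
  rewrite normr1 norm_dirichlet_term rmorphD rmorph1 lerD2l lecR.
  exact: le_zeta_term.
(* If [S < P], then [Q m >= 1] keeps the difference of the two sequences at most [S - P < 0],
   although it tends to [1 - 1 = 0]. *)
rewrite leNgt; apply/negP => SP.
have : complex.Re (1 : R[i]) - complex.Re (1 : R[i]) <= S - P.
  apply: (cvgr_to_le (cvgB cS cP)); near=> m.
  apply: le_trans (_ : (S - P) * Q m <= _).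
    by rewrite mulrBl -PE; exact: lerB (SE m) (lexx _).
  by rewrite ler_neMr// subr_le0 ltW.
by rewrite subrr subr_ge0 leNgt SP.
Unshelve. all: end_near.
Qed.

(* The order of R[i] relates numbers with equal imaginary parts, so the
   inequalities also say that both bounds are real. *)
Theorem proposition2p3 (R : realType) (x : nat -> R) (K : set R[i])
    (sigma0 : R) (K_strip : closed_strip K)
    (sigma0_min : is_minimum [set complex.Re s | s in K] sigma0) :
  forall s : R[i], K s ->
    zeta_seq (fun _ : nat => pi) sigma0%:C <= `|zeta_seq x s|
      <= riemann_zeta sigma0%:C.
Proof.
move=> s Ks; case: sigma0_min => -[s0 Ks0 s0E] sigma0_le.
have sigma0_s : sigma0 <= complex.Re s by apply: sigma0_le; exists s.
(* The minimum is attained at [s0] in the strip, hence is at least the left edge [a > 1]. *)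
have sigma0_gt1 : 1 < sigma0.
  case: K_strip Ks0 => a [b [a1 _ ->]] /= /andP[a_s0 _].
  by rewrite -s0E (lt_le_trans a1).
by rewrite norm_zeta_seq_ge// norm_zeta_seq_le.
Qed.
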